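(* Let $X$ be a Banach space and let $A$ be a continuous map from $\mathbb R$ to the space of all bounded linear operators on $X$ with $\sup_{t\in\mathbb R}\|A(t)\|<\infty$. Suppose that the linear evolution family $T(t,s)$ associated with $x'=A(t)x$ admits an exponential trichotomy. Then for all sufficiently small $c>0$ the following holds (i.e. there is $c_0>0$, depending only on $A$, such that it holds for every $0<c<c_0$): for every continuous map $f\colon\mathbb R\times X\to X$ with $f(t,0)=0$ for all $t\in\mathbb R$ and $$\|f(t,x)-f(t,y)\|\le c\|x-y\|\quad\text{for all } t\in\mathbb R,\ x,y\in X,$$ the equation $x'=A(t)x+f(t,x)$ has the Lipschitz shadowing property.
   Context: **Exponential trichotomy.** Let $T(t,s)$, $t,s\in\mathbb R$, be the linear evolution family of $x'=A(t)x$, i.e. $T(t,s)x(s)=x(t)$ for every solution $x$. It admits an exponential trichotomy if there exist projections $P^i(s)$ on $X$, $s\in\mathbb R$, $i\in\{1,2,3\}$, and $C,\lambda>0$ such that: (1) $P^1(s)+P^2(s)+P^3(s)=\mathrm{Id}$; (2) $P^i(s)P^j(s)=0$ for $i\ne j$; (3) $T(t,s)P^i(s)=P^i(t)T(t,s)$ for all $t,s\in\mathbb R$ and $i\in\{1,2,3\}$; (4) $\|T(t,s)P^1(s)\|\le Ce^{-\lambda(t-s)}$ for $t\ge s$; (5) $\|T(t,s)P^2(s)\|\le Ce^{-\lambda(s-t)}$ for $t\le s$; (6) $\|T(t,s)P^3(s)\|\le Ce^{-\lambda(t-s)}$ for $t\ge s\ge 0$ and $\|T(t,s)P^3(s)\|\le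 Ce^{-\lambda(s-t)}$ for $t\le s\le 0$. **Shadowing.** For $\delta>0$, a differentiable function $y\colon\mathbb R\to X$ is a $\delta$-pseudotrajectory for $x'=A(t)x+f(t,x)$ if $\sup_{t\in\mathbb R}\|y'(t)-A(t)y(t)-f(t,y(t))\|\le\delta$. The equation has the shadowing property if for every $\varepsilon>0$ there is $\delta>0$ such that for every $\delta$-pseudotrajectory $y\colon\mathbb R\to X$ there is a solution $x\colon\mathbb R\to X$ of the equation with $\sup_{t\in\mathbb R}\|x(t)-y(t)\|\le\varepsilon$. It has the Lipschitz shadowing property if moreover there is $L>0$ (independent of $\varepsilon$) such that one can take $\delta=L\varepsilon$. *)

(* Defs.v *)
From Stdlib Require Import Reals.
From Coquelicot Require Import Coquelicot.

Open Scope R_scope.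

(* Suprema are taken in the extended reals, so that [sup f <= c] and
   [sup f < p_infty] carry no hidden finiteness assumption. *)
Definition sup {I : Type} (f : I -> Rbar) : Rbar :=
  Rbar_lub (fun r => exists i, r = f i).

(* Bounded linear operators are functions satisfying Coquelicot's [is_linear],
   which includes the existence of a norm bound. *)
Definition op_norm {X : NormedModule R_AbsRing} (B : X -> X) : Rbar :=
  sup (fun v : {v : X | norm v <= 1} => Finite (norm (B (proj1_sig v)))).

Definition op_continuous {X : NormedModule R_AbsRing} (A : R -> X -> X) : Prop :=
  forall (t : R) (eps : posreal),
    locally t (fun s => Rbar_lt (op_norm (fun v => minus (A s v) (A t v))) eps).

Definition is_solution {X : NormedModule R_AbsRing} (F : R -> X -> X)
    (x : R -> X) : Prop :=
  forall t, is_derive x t (F t (x t)).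

Definition is_evolution_family {X : NormedModule R_AbsRing}
    (A : R -> X -> X) (T : R -> R -> X -> X) : Prop :=
  (forall t s, is_linear (T t s)) /\
  (forall x, is_solution A x -> forall t s, T t s (x s) = x t).

Definition is_projection {X : NormedModule R_AbsRing} (P : X -> X) : Prop :=
  is_linear P /\ forall v, P (P v) = P v.

Inductive index3 : Set := i1 | i2 | i3.

Record is_trichotomy {X : NormedModule R_AbsRing} (T : R -> R -> X -> X)
    (P : index3 -> R -> X -> X) (C lambda : R) : Prop := {
  trich_proj : forall i s, is_projection (P i s);
  trich_sum : forall s v, plus (plus (P i1 s v) (P i2 s v)) (P i3 s v) = v;
  trich_orth : forall i j s v, i <> j -> P i s (P j s v) = zero;
  trich_comm : forall i t s v, T t s (P i s v) = P i t (T t s v);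
  trich_stable : forall t s, s <= t ->
    Rbar_le (op_norm (fun v => T t s (P i1 s v))) (C * exp (- lambda * (t - s)));
  trich_unstable : forall t s, t <= s ->
    Rbar_le (op_norm (fun v => T t s (P i2 s v))) (C * exp (- lambda * (s - t)));
  trich_forward : forall t s, 0 <= s <= t ->
    Rbar_le (op_norm (fun v => T t s (P i3 s v))) (C * exp (- lambda * (t - s)));
  trich_backward : forall t s, t <= s <= 0 ->
    Rbar_le (op_norm (fun v => T t s (P i3 s v))) (C * exp (- lambda * (s - t)))
}.

Definition exponential_trichotomy {X : NormedModule R_AbsRing}
    (T : R -> R -> X -> X) : Prop :=
  exists (P : index3 -> R -> X -> X) (C lambda : R),
    0 < C /\ 0 < lambda /\ is_trichotomy T P C lambda.

(* [y] is only assumed differentiable: [dy] need not be continuous. *)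
Definition pseudotrajectory {X : NormedModule R_AbsRing} (F : R -> X -> X)
    (delta : R) (y : R -> X) : Prop :=
  exists dy : R -> X,
    (forall t, is_derive y t (dy t)) /\
    Rbar_le (sup (fun t => Finite (norm (minus (dy t) (F t (y t)))))) delta.

Definition shadowable {X : NormedModule R_AbsRing} (F : R -> X -> X)
    (eps delta : R) : Prop :=
  forall y, pseudotrajectory F delta y ->
    exists x, is_solution F x /\
      Rbar_le (sup (fun t => Finite (norm (minus (x t) (y t))))) eps.

Definition shadowing {X : NormedModule R_AbsRing} (F : R -> X -> X) : Prop :=
  forall eps, 0 < eps -> exists delta, 0 < delta /\ shadowable F eps delta.

Definition lipschitz_shadowing {X : NormedModule R_AbsRing}
    (F : R -> X -> X) : Prop :=
  shadowing F /\
  exists L, 0 < L /\ forall eps, 0 < eps -> shadowable F eps (L * eps).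

(* Main.v *)
Require Import Defs.
From Stdlib Require Import ssreflect Reals Lra Lia ClassicalEpsilon.
From Coquelicot Require Import Coquelicot.

Open Scope R_scope.

(** The proof corrects an approximate solution until it is exact. Write
    [F t x = A t x + f t x], and call [r t = F t (x t) - x' t] the residual of a
    curve [x].

    If [r] is continuous and bounded by [rho], and [u] is a bounded solution of
    [u' = A u + r], then the residual of [x + u] is
    [f t (x t + u t) - f t (x t)]: the linear part cancels, so the new residual is
    at most [c] times the size of [u]. The trichotomy provides such a [u] of size
    at most [kappa * rho] with [kappa = 3 * C / lambda]
    ([bounded_solution_exists]). Once [c * kappa < 1], iterating gives residuals
    that decrease geometrically, and the curves converge uniformly to a solution
    at a distance from [x] proportional to [rho] ([successive_corrections]).

    The bounded [u] comes from variation of constants. Seen from time [0], the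
    forcing [g] has the three components [P i 0 (T 0 s (g s))], with primitives
    [W i] that vanish at [0]. Along the flow the stable component decays from the
    past, so it is integrated from [-oo]; the unstable component is integrated
    from [+oo]; the third decays away from [0] in both directions, so it is
    integrated from [0]. Each contributes at most [C * rho / lambda].

    A pseudotrajectory [y] is only differentiable, so its residual need not be
    continuous and cannot be used in these integrals. It is first replaced by a
    nearby continuously differentiable curve ([pseudotrajectory_smoothing]):
    subtracting a primitive of [F t (y t)] from [y] leaves a [delta]-Lipschitz
    remainder, and averaging this remainder over [[t, t + 1]] moves it by at most
    [delta].

    The hypothesis on [T] describes it on solutions only, so the solvability of
    the linear Cauchy problem has to be shown as well. It follows from the same
    correction scheme, with [u] a primitive of [r] and with exponential weights
    ([cauchy_problem_solvable]). *)

(** * Suprema and geometric errors *)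

Lemma sup_is_lub {I : Type} (h : I -> Rbar) :
  Rbar_is_lub (fun r => exists i, r = h i) (sup h).
Proof. exact (proj2_sig (Rbar_ex_lub _)). Qed.

Lemma sup_ge {I : Type} (h : I -> Rbar) (i : I) : Rbar_le (h i) (sup h).
Proof. apply (proj1 (sup_is_lub h)). exists i. reflexivity. Qed.

Lemma sup_le {I : Type} (h : I -> Rbar) (b : Rbar) :
  (forall i, Rbar_le (h i) b) -> Rbar_le (sup h) b.
Proof. intros H. apply (proj2 (sup_is_lub h)). intros r [i ->]. apply H. Qed.

Lemma exp_INR_mult (a : R) (n : nat) : exp (a * INR n) = exp a ^ n.
Proof.
  induction n as [|n IH]; [simpl; rewrite Rmult_0_r; apply exp_0|].
  rewrite S_INR Rmult_plus_distr_l exp_plus IH Rmult_1_r. simpl. ring.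
Qed.

Lemma is_lim_seq_scaled_geom (C q : R) :
  0 <= q < 1 -> is_lim_seq (fun n => C * q ^ n) 0.
Proof.
  intros Hq. replace (Finite 0) with (Rbar_mult C 0) by (simpl; f_equal; ring).
  apply is_lim_seq_scal_l, is_lim_seq_geom. rewrite Rabs_pos_eq; lra.
Qed.

Lemma le_of_geometric_error (a b D q : R) (N : nat) :
  0 <= q < 1 -> (forall n, (N <= n)%nat -> a <= b + D * q ^ n) -> a <= b.
Proof.
  intros Hq H.
  apply (is_lim_seq_le_loc (fun _ => a) (fun n => b + D * q ^ n) (Finite a) (Finite b)).
  - exists N. exact H.
  - apply is_lim_seq_const.
  - replace (Finite b) with (Rbar_plus b 0) by (simpl; f_equal; ring).
    apply (is_lim_seq_plus' (fun _ => b)); [apply is_lim_seq_const|].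
    apply is_lim_seq_scaled_geom, Hq.
Qed.

(** * Norm estimates *)

Lemma plus_opp_head {G : AbelianGroup} (x r : G) :
  plus x (plus (opp x) r) = r.
Proof. rewrite plus_assoc plus_opp_r. apply plus_zero_l. Qed.

Lemma opp_plus_head {G : AbelianGroup} (x r : G) :
  plus (opp x) (plus x r) = r.
Proof. rewrite plus_assoc plus_opp_l. apply plus_zero_l. Qed.

Lemma eq_of_diff_zero {G : AbelianGroup} (a b : G) :
  plus a (plus (opp b) zero) = zero -> a = b.
Proof.
  intros H. rewrite plus_zero_r in H.
  apply (plus_reg_r (opp b)). rewrite H. symmetry. apply plus_opp_r.
Qed.

Lemma rotate_summand {G : AbelianGroup} (x y r : G) :
  plus x (plus r (plus y zero)) = zero -> plus x (plus y r) = zero.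
Proof. rewrite plus_zero_r (plus_comm r y). trivial. Qed.

(** Decides equations between signed sums in an abelian group: the difference
    of the sides is flattened, and the leading summand is paired with its
    opposite, which is found by rotating the other summands. *)
Ltac abelian :=
  rewrite /minus;
  apply: eq_of_diff_zero;
  rewrite ?(opp_plus, opp_opp, opp_zero, plus_zero_l, plus_zero_r) -?plus_assoc;
  repeat first
    [ reflexivity
    | progress rewrite ?(plus_opp_head, opp_plus_head, plus_opp_r, plus_opp_l,
                         plus_zero_l, plus_zero_r)
    | apply: rotate_summand; rewrite ?plus_zero_r -?plus_assoc ].

Section NormedModule.

Context {X : NormedModule R_AbsRing}.

Lemma norm_minus_sym (x y : X) : norm (minus x y) = norm (minus y x).
Proof. rewrite -(norm_opp (minus x y)) opp_minus. reflexivity. Qed.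

Lemma norm_minus_trans (x y z : X) :
  norm (minus x z) <= norm (minus x y) + norm (minus y z).
Proof. rewrite (minus_trans y). apply norm_triangle. Qed.

Lemma norm_le_minus (x y : X) : norm x <= norm (minus x y) + norm y.
Proof.
  replace x with (plus (minus x y) y) at 1 by abelian. apply norm_triangle.
Qed.

Lemma norm_minus_le (x y : X) : norm (minus x y) <= norm x + norm y.
Proof.
  unfold minus. rewrite -(norm_opp y). apply norm_triangle.
Qed.

Lemma norm_minus_zero_eq (x y : X) : norm (minus x y) <= 0 -> x = y.
Proof.
  intros H. assert (E : minus x y = zero).
  { apply norm_eq_zero. pose proof (norm_ge_0 (minus x y)). lra. }
  replace x with (plus (minus x y) y) by abelian.
  rewrite E. apply plus_zero_l.
Qed.

(** Scaling to the unit ball. Homogeneity is checked at once for the differences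
    and composites of linear operators to which this is applied. *)
Lemma op_norm_bound (B : X -> X) (c : R) :
  (forall (k : R) v, B (scal k v) = scal k (B v)) ->
  Rbar_le (op_norm B) (Finite c) -> forall v, norm (B v) <= c * norm v.
Proof.
  intros HB Hc v.
  assert (Hunit : forall u, norm u <= 1 -> norm (B u) <= c).
  { intros u Hu.
    exact (Rbar_le_trans (Finite _) _ (Finite _)
             (sup_ge (fun v : {v : X | norm v <= 1} => Finite (norm (B (proj1_sig v))))
                (exist _ u Hu)) Hc). }
  destruct (Req_dec (norm v) 0) as [E|E].
  - rewrite E Rmult_0_r. apply norm_eq_zero in E. right.
    rewrite E -(scal_zero_l zero) HB scal_zero_l. apply: norm_zero.
  - assert (Hv : 0 < norm v) by (pose proof (norm_ge_0 v); lra).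
    set (u := scal (/ norm v) v).
    assert (Hvu : v = scal (norm v) u).
    { unfold u. rewrite scal_assoc. change (mult (norm v) (/ norm v)) with (norm v * / norm v).
      rewrite Rinv_r; [symmetry; apply: scal_one | exact E]. }
    assert (Hu : norm u <= 1).
    { unfold u. eapply Rle_trans; [apply: norm_scal|].
      change (abs (/ norm v)) with (Rabs (/ norm v)).
      rewrite Rabs_pos_eq; [|left; apply Rinv_0_lt_compat, Hv].
      right. field. exact E. }
    rewrite {1}Hvu HB. eapply Rle_trans; [apply: norm_scal|].
    change (abs (norm v)) with (Rabs (norm v)). rewrite Rabs_pos_eq; [|lra].
    rewrite Rmult_comm. apply Rmult_le_compat_r; [lra | apply Hunit, Hu].
Qed.

Lemma continuous_norm_lt (f : R -> X) (t : R) :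
  continuous f t <->
  forall eps, 0 < eps -> locally t (fun s => norm (minus (f s) (f t)) < eps).
Proof.
  unfold continuous. rewrite filterlim_locally_ball_norm. split.
  - intros H eps He. exact (H (mkposreal eps He)).
  - intros H eps. exact (H eps (cond_pos eps)).
Qed.

(** * Derivatives and increments *)

Lemma is_derive_continuous (f : R -> X) (t : R) (l : X) :
  is_derive f t l -> continuous f t.
Proof. intros H. apply ex_derive_continuous. exists l. exact H. Qed.

Lemma is_derive_eq (f : R -> X) (t : R) (l l' : X) :
  is_derive f t l -> l = l' -> is_derive f t l'.
Proof. intros H <-. exact H. Qed.

Lemma is_derive_domin (f : R -> X) (t : R) (l : X) :
  is_derive f t l <->
  forall eps, 0 < eps -> locally t (fun s =>
    norm (minus (minus (f s) (f t)) (scal (s - t) l)) <= eps * Rabs (s - t)).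
Proof.
  split.
  - intros [_ H] eps He.
    exact (H t (fun P HP => HP) (mkposreal eps He)).
  - intros H. split; [apply is_linear_scal_l|].
    intros x Hx eps.
    rewrite -(is_filter_lim_locally_unique _ _ Hx).
    exact (H eps (cond_pos eps)).
Qed.

Lemma is_derive_locally_lipschitz (f : R -> X) (t : R) (l : X) (eps : R) :
  is_derive f t l -> 0 < eps -> locally t (fun s =>
    norm (minus (f s) (f t)) <= (norm l + eps) * Rabs (s - t)).
Proof.
  intros H He. rewrite is_derive_domin in H.
  generalize (H eps He). apply filter_imp. intros s Hs.
  eapply Rle_trans; [apply (norm_le_minus _ (scal (s - t) l))|].
  eapply Rle_trans;
    [apply (Rplus_le_compat _ _ _ _ Hs (norm_scal (s - t) l))|].
  change (abs (s - t)) with (Rabs (s - t)). lra.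
Qed.

(** Derivatives are not assumed continuous here, so the increment cannot be
    written as an integral. Up to a slope [eps], the increment bound holds
    near each point, and it is additive over adjacent intervals; so the
    supremum of the points that it reaches from [a] must be [b]. *)
Lemma norm_increment_le_eps (F dF : R -> X) (k dk : R -> R) (a b eps : R) :
  a <= b -> 0 < eps ->
  (forall t, a <= t <= b -> is_derive F t (dF t)) ->
  (forall t, a <= t <= b -> is_derive k t (dk t)) ->
  (forall t, a <= t <= b -> norm (dF t) <= dk t) ->
  norm (minus (F b) (F a)) <= k b - k a + eps * (b - a).
Proof.
  intros Hab He HF Hk Hle.
  set (good := fun s t => norm (minus (F t) (F s)) <= k t - k s + eps * (t - s)).
  assert (good_trans : forall r s t, good r s -> good s t -> good r t).
  { unfold good. intros r s t H1 H2.
    pose proof (norm_minus_trans (F t) (F s) (F r)). lra. }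
  assert (good_near : forall t, a <= t <= b -> exists d : posreal, forall s,
             Rabs (s - t) < d -> (t <= s -> good t s) /\ (s <= t -> good s t)).
  { intros t Ht.
    assert (He2 : 0 < eps / 2) by lra.
    pose proof (is_derive_locally_lipschitz _ _ _ _ (HF t Ht) He2) as H1.
    pose proof (proj1 (@is_derive_Reals k t (dk t)) (Hk t Ht)) as H2.
    destruct (H2 (eps / 2) He2) as [d2 Hd2].
    destruct H1 as [d1 Hd1].
    assert (Hd : 0 < Rmin d1 d2) by (apply Rmin_pos; apply cond_pos).
    exists (mkposreal _ Hd). simpl. intros s Hs.
    assert (Hs1 : Rabs (s - t) < d1) by (eapply Rlt_le_trans; [exact Hs | apply Rmin_l]).
    assert (Hs2 : Rabs (s - t) < d2) by (eapply Rlt_le_trans; [exact Hs | apply Rmin_r]).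
    specialize (Hd1 s Hs1). simpl in Hd1.
    pose proof (Hle t Ht) as Hn.
    assert (Hk2 : Rabs (k s - k t - dk t * (s - t)) <= eps / 2 * Rabs (s - t)).
    { destruct (Req_dec (s - t) 0) as [E|E].
      - replace s with t by lra. replace (k t - k t - dk t * (t - t)) with 0 by ring.
        rewrite Rabs_R0 Rminus_diag Rabs_R0. lra.
      - pose proof (Hd2 (s - t) E Hs2) as H3.
        replace (t + (s - t)) with s in H3 by ring.
        replace (k s - k t - dk t * (s - t))
          with (((k s - k t) / (s - t) - dk t) * (s - t)) by (field; exact E).
        rewrite Rabs_mult. apply Rmult_le_compat_r; [apply Rabs_pos | lra]. }
    unfold good. split; intros Hst.
    - rewrite (Rabs_pos_eq (s - t)) in Hd1 Hk2; [|lra..].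
      apply Rabs_le_between in Hk2. nra.
    - rewrite norm_minus_sym. rewrite (Rabs_left1 (s - t)) in Hd1 Hk2; [|lra..].
      apply Rabs_le_between in Hk2. nra. }
  set (S := fun t => a <= t <= b /\ good a t).
  assert (Sa : S a).
  { split; [lra|]. unfold good. rewrite minus_eq_zero norm_zero. lra. }
  destruct (completeness S) as [m [Hub Hlub]].
  { exists b. intros t [Ht _]. lra. }
  { exists a. exact Sa. }
  assert (Hm : a <= m <= b).
  { split; [apply Hub, Sa | apply Hlub; intros t [Ht _]; lra]. }
  destruct (good_near m Hm) as [d Hd]. pose proof (cond_pos d).
  assert (Sm : good a m).
  { destruct (classic (exists t, S t /\ m - d < t)) as [[t [[Ht St] Htd]]|Hno].
    - assert (t <= m) by (apply Hub; split; assumption).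
      apply (good_trans a t m St). apply Hd; [|lra].
      rewrite Rabs_left1; lra.
    - exfalso. assert (m <= m - d); [|lra].
      apply Hlub. intros t St. apply Rnot_lt_le. intros Hlt. apply Hno.
      exists t. split; assumption. }
  destruct (Req_dec m b) as [<-|Hmb]; [exact Sm|].
  exfalso.
  set (s := Rmin b (m + d / 2)).
  assert (Hs : m < s <= b /\ s <= m + d / 2).
  { unfold s. repeat split; [apply Rmin_glb_lt; lra | apply Rmin_l | apply Rmin_r]. }
  assert (s <= m); [|lra].
  apply Hub. split; [lra|]. apply (good_trans a m s Sm).
  apply Hd; [rewrite Rabs_pos_eq; lra | lra].
Qed.

Lemma norm_increment_le (F dF : R -> X) (k dk : R -> R) (a b : R) :
  a <= b ->
  (forall t, a <= t <= b -> is_derive F t (dF t)) ->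
  (forall t, a <= t <= b -> is_derive k t (dk t)) ->
  (forall t, a <= t <= b -> norm (dF t) <= dk t) ->
  norm (minus (F b) (F a)) <= k b - k a.
Proof.
  intros Hab HF Hk Hle. apply Rle_plus_epsilon. intros eps He.
  assert (He' : 0 < eps / (b - a + 1)) by (apply Rdiv_lt_0_compat; lra).
  pose proof (norm_increment_le_eps F dF k dk a b _ Hab He' HF Hk Hle) as H.
  assert (eps / (b - a + 1) * (b - a) <= eps); [|lra].
  replace eps with (eps / (b - a + 1) * (b - a + 1)) at 2 by (field; lra).
  apply Rmult_le_compat_l; lra.
Qed.

Lemma norm_increment_le_abs (F dF : R -> X) (k dk : R -> R) (a b : R) :
  (forall t, is_derive F t (dF t)) ->
  (forall t, is_derive k t (dk t)) ->
  (forall t, norm (dF t) <= dk t) ->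
  norm (minus (F b) (F a)) <= Rabs (k b - k a).
Proof.
  intros HF Hk Hle. destruct (Rle_dec a b) as [H|H].
  - eapply Rle_trans; [|apply Rle_abs]. eapply norm_increment_le; eauto.
  - rewrite norm_minus_sym Rabs_minus_sym.
    eapply Rle_trans; [|apply Rle_abs]. eapply norm_increment_le; eauto; lra.
Qed.

Lemma norm_increment_le_const (F dF : R -> X) (c a b : R) :
  (forall t, Rmin a b <= t <= Rmax a b -> is_derive F t (dF t)) ->
  (forall t, Rmin a b <= t <= Rmax a b -> norm (dF t) <= c) ->
  norm (minus (F b) (F a)) <= c * Rabs (b - a).
Proof.
  assert (main : forall a b, a <= b ->
    (forall t, a <= t <= b -> is_derive F t (dF t)) ->
    (forall t, a <= t <= b -> norm (dF t) <= c) ->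
    norm (minus (F b) (F a)) <= c * (b - a)).
  { clear a b. intros a b Hab HF Hle.
    replace (c * (b - a)) with (c * b - c * a) by ring.
    apply (norm_increment_le F dF (fun t => c * t) (fun _ => c)); trivial.
    intros t _. auto_derive; [trivial | ring]. }
  intros HF Hle. destruct (Rle_dec a b) as [H|H].
  - rewrite (Rmin_left a b) ?(Rmax_right a b) in HF Hle; [|lra..].
    rewrite Rabs_pos_eq; [auto | lra].
  - rewrite (Rmin_right a b) ?(Rmax_left a b) in HF Hle; [|lra..].
    rewrite norm_minus_sym Rabs_minus_sym Rabs_pos_eq; [apply main; auto; lra | lra].
Qed.

Lemma is_derive_linear (B : X -> X) (w : R -> X) (t : R) (l : X) :
  is_linear B -> is_derive w t l -> is_derive (fun s => B (w s)) t (B l).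
Proof.
  intros HB Hw.
  eapply filterdiff_ext_lin;
    [apply (filterdiff_comp' w B t _ B Hw); apply filterdiff_linear, HB|].
  intros y. simpl. apply (linear_scal _ HB).
Qed.

End NormedModule.

Section Complete.

Context {Xc : CompleteNormedModule R_AbsRing}.
(* Working in the underlying normed module keeps all norms and sums in one
   syntactic form, which the arithmetic tactics rely on. *)
Local Notation X := (CompleteNormedModule.NormedModule R_AbsRing Xc).

(** * Primitives and limits *)

Lemma primitive_exists (g : R -> X) (a : R) :
  (forall t, continuous g t) ->
  exists G : R -> X, G a = zero /\ forall t, is_derive G t (g t).
Proof.
  intros Hg. exists (RInt (V := Xc) g a). split; [apply RInt_point|].
  intros t. apply (is_derive_RInt _ _ a); [|apply Hg].
  apply filter_forall. intros s. apply (RInt_correct (V := Xc)), (ex_RInt_continuous (V := Xc)).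
  intros; apply Hg.
Qed.

(** The explicit rate [e] passes to the limit and controls the distance to it. *)
Lemma cauchy_limit (u : nat -> X) (e : nat -> R) :
  (forall n m, norm (minus (u (n + m)%nat) (u n)) <= e n) ->
  is_lim_seq e 0 ->
  exists l, forall n, norm (minus l (u n)) <= e n.
Proof.
  intros Hu He.
  assert (He' : forall eps, 0 < eps -> eventually (fun n => e n < eps)).
  { intros eps Heps. apply is_lim_seq_spec in He.
    destruct (He (mkposreal eps Heps)) as [N HN]. exists N. intros n Hn.
    specialize (HN n Hn). simpl in HN. rewrite Rminus_0_r in HN.
    eapply Rle_lt_trans; [apply Rle_abs | exact HN]. }
  destruct (proj1 (filterlim_locally_cauchy (F := eventually) u)) as [l Hl].
  { intros eps. destruct (He' (eps / 2)) as [N HN]; [pose proof (cond_pos eps); lra|].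
    exists (fun n => (N <= n)%nat). split; [exists N; auto|].
    intros n m Hn Hm. apply: norm_compat1.
    eapply Rle_lt_trans; [apply (norm_minus_trans _ (u N))|].
    rewrite (norm_minus_sym (u N)).
    pose proof (Hu N (n - N)%nat) as H1. pose proof (Hu N (m - N)%nat) as H2.
    replace (N + (n - N))%nat with n in H1 by lia.
    replace (N + (m - N))%nat with m in H2 by lia.
    eapply Rle_lt_trans; [apply (Rplus_le_compat _ _ _ _ H2 H1)|].
    specialize (HN N (Nat.le_refl N)). lra. }
  exists l. intros n. apply Rle_plus_epsilon. intros eps Heps.
  rewrite filterlim_locally_ball_norm in Hl.
  destruct (Hl (mkposreal eps Heps)) as [N HN].
  specialize (HN (n + N)%nat ltac:(lia)). unfold ball_norm in HN. simpl in HN.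
  rewrite norm_minus_sym in HN.
  eapply Rle_trans; [apply (norm_minus_trans l (u (n + N)%nat) (u n))|].
  eapply Rle_trans; [apply (Rplus_le_compat _ _ _ _ (Rlt_le _ _ HN) (Hu n N))|].
  lra.
Qed.

Lemma continuous_uniform_limit (z : R -> X) (t : R) :
  (forall eps, 0 < eps -> exists y : R -> X, continuous y t /\
     locally t (fun s => norm (minus (z s) (y s)) < eps)) ->
  continuous z t.
Proof.
  intros H. apply (proj2 (continuous_norm_lt z t)). intros eps He.
  destruct (H (eps / 3)) as [y [Hy Hzy]]; [lra|].
  pose proof (locally_singleton _ _ Hzy) as Ht.
  pose proof (proj1 (continuous_norm_lt y t) Hy (eps / 3) ltac:(lra)) as Hy'.
  generalize (filter_and _ _ Hzy Hy'). apply filter_imp. intros s [H1 H2].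
  pose proof (norm_minus_trans (z s) (y s) (z t)).
  pose proof (norm_minus_trans (y s) (y t) (z t)).
  rewrite (norm_minus_sym (z t)) in Ht. lra.
Qed.

(** * Solutions from successive corrections of the residual *)

(** The derivative of [x] is written as the field minus the residual, so that a
    bound on the residual carries its continuity and the regularity of [x]. *)
Definition residual_bounded (F : R -> X -> X) (x : R -> X) (b : R -> R) : Prop :=
  exists r : R -> X,
    (forall t, continuous r t) /\
    (forall t, is_derive x t (minus (F t (x t)) (r t))) /\
    (forall t, norm (r t) <= b t).

Definition locally_bounded (b : R -> R) : Prop :=
  forall T, exists B, forall t, Rabs t <= T -> b t <= B.

(** The only way in which continuity of the field is used; it follows from joint
    continuity as well as from operator-norm continuity of a linear field. *)
Definition preserves_continuity (F : R -> X -> X) : Prop :=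
  forall x : R -> X, (forall t, continuous x t) ->
  forall t, continuous (fun s => F s (x s)) t.

Definition lipschitz_field (F : R -> X -> X) (K : R) : Prop :=
  forall t x y, norm (minus (F t x) (F t y)) <= K * norm (minus x y).

Lemma residual_bounded_continuous (F : R -> X -> X) (x : R -> X) (b : R -> R) t :
  residual_bounded F x b -> continuous x t.
Proof. intros (r & _ & Hx & _). eapply is_derive_continuous, Hx. Qed.

(** Derivatives of the [xs n] are not known to converge before the limit is known
    to be continuous. So [z] is compared with a primitive [G] of [F t (z t)]: the
    derivative of [xs n - G] tends to zero uniformly on compact intervals, hence
    [z - G] is constant. *)
Lemma is_solution_of_approximations (F : R -> X -> X) (K C q : R) (w v : R -> R)
    (xs : nat -> R -> X) (z : R -> X) :
  preserves_continuity F -> lipschitz_field F K -> 0 <= K ->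
  0 <= q < 1 -> 0 <= C -> locally_bounded w -> locally_bounded v ->
  (forall n, residual_bounded F (xs n) (fun t => C * q ^ n * w t)) ->
  (forall n t, norm (minus (z t) (xs n t)) <= C * q ^ n * v t) ->
  is_solution F z.
Proof.
  intros HF HK K0 Hq HC Hw Hv Hxs Hz.
  assert (Cq : forall n, 0 <= C * q ^ n).
  { intros n. apply Rmult_le_pos; [exact HC | apply pow_le; lra]. }
  assert (zc : forall t, continuous z t).
  { intros t. apply continuous_uniform_limit. intros eps He.
    destruct (Hv (Rabs t + 1)) as [B HB].
    pose proof (is_lim_seq_scaled_geom (C * Rabs B) q Hq) as Hlim.
    apply is_lim_seq_spec in Hlim.
    destruct (Hlim (mkposreal eps He)) as [n Hn].
    specialize (Hn n (Nat.le_refl n)). simpl in Hn. rewrite Rminus_0_r in Hn.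
    exists (xs n). split; [eapply residual_bounded_continuous, Hxs|].
    exists (mkposreal 1 Rlt_0_1). intros s Hs.
    change (Rabs (s - t) < 1) in Hs.
    eapply Rle_lt_trans; [apply Hz|].
    eapply Rle_lt_trans; [|eapply Rle_lt_trans; [apply Rle_abs | exact Hn]].
    replace (C * Rabs B * q ^ n) with (C * q ^ n * Rabs B) by ring.
    apply Rmult_le_compat_l; [apply Cq|].
    eapply Rle_trans; [apply HB | apply Rle_abs].
    pose proof (Rabs_triang_inv s t). lra. }
  destruct (primitive_exists (fun s => F s (z s)) 0 (HF z zc)) as [G [_ HG]].
  assert (Heq : forall t, minus (z t) (G t) = minus (z 0) (G 0)).
  { intros t. apply norm_minus_zero_eq.
    destruct (Hv (Rabs t)) as [Bv HBv]. destruct (Hw (Rabs t)) as [Bw HBw].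
    set (D := C * (2 * Bv + (K * Bv + Bw) * Rabs t)).
    apply (le_of_geometric_error _ 0 D q 0 Hq). intros n _. rewrite Rplus_0_l.
    destruct (Hxs n) as (r & rc & Hx & Hr).
    assert (H0 : Rabs 0 <= Rabs t) by (rewrite Rabs_R0; apply Rabs_pos).
    assert (Hvn : forall s, Rabs s <= Rabs t ->
              norm (minus (z s) (xs n s)) <= C * q ^ n * Bv).
    { intros s Hs. eapply Rle_trans; [apply Hz|].
      apply Rmult_le_compat_l; [apply Cq | apply HBv, Hs]. }
    assert (Hinc : norm (minus (minus (xs n t) (G t)) (minus (xs n 0) (G 0)))
                   <= C * q ^ n * (K * Bv + Bw) * Rabs (t - 0)).
    { apply (norm_increment_le_const (fun s => minus (xs n s) (G s))
               (fun s => minus (minus (F s (xs n s)) (r s)) (F s (z s)))).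
      - intros s _. apply: is_derive_minus; [apply Hx | apply HG].
      - intros s Hs.
        assert (Hs' : Rabs s <= Rabs t).
        { revert Hs. unfold Rmin, Rmax, Rabs.
          destruct (Rle_dec 0 t), (Rcase_abs s), (Rcase_abs t); lra. }
        replace (minus (minus (F s (xs n s)) (r s)) (F s (z s)))
          with (minus (minus (F s (xs n s)) (F s (z s))) (r s)) by abelian.
        pose proof (norm_minus_le (minus (F s (xs n s)) (F s (z s))) (r s)).
        pose proof (HK s (xs n s) (z s)) as H1.
        rewrite (norm_minus_sym (xs n s)) in H1.
        pose proof (Rmult_le_compat_l K _ _ K0 (Hvn s Hs')).
        pose proof (Hr s).
        pose proof (Rmult_le_compat_l _ _ _ (Cq n) (HBw s Hs')). lra. }
    rewrite Rminus_0_r in Hinc.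
    replace (minus (minus (z t) (G t)) (minus (z 0) (G 0)))
      with (plus (minus (minus (xs n t) (G t)) (minus (xs n 0) (G 0)))
                 (minus (minus (z t) (xs n t)) (minus (z 0) (xs n 0)))) by abelian.
    eapply Rle_trans; [apply norm_triangle|].
    eapply Rle_trans; [apply Rplus_le_compat; [exact Hinc | apply norm_minus_le]|].
    pose proof (Hvn t (Rle_refl _)). pose proof (Hvn 0 H0). unfold D.
    eapply Rle_trans; [apply Rplus_le_compat_l, Rplus_le_compat; eassumption|].
    right; ring. }
  intros t. apply (is_derive_ext (fun s => plus (G s) (minus (z 0) (G 0)))).
  { intros s. rewrite -(Heq s). abelian. }
  eapply is_derive_eq; [apply: is_derive_plus; [apply HG | apply is_derive_const]|].
  apply plus_zero_r.
Qed.

(** If every residual of weight [rho * w] can be reduced by the factor [q] at the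
    cost of moving the curve by [rho * v], then the moves sum to a geometric
    series and the limit is a solution. Separate weights are needed because the
    correction may be required to vanish where the residual does not: [v s = 0]
    keeps the value at [s], which is how an initial condition is preserved. *)
Lemma successive_corrections (F : R -> X -> X) (K q : R) (w v : R -> R) :
  preserves_continuity F -> lipschitz_field F K -> 0 <= K -> 0 <= q < 1 ->
  locally_bounded w -> locally_bounded v -> (forall t, 0 <= v t) ->
  (forall x rho, 0 <= rho -> residual_bounded F x (fun t => rho * w t) ->
     exists x', residual_bounded F x' (fun t => rho * q * w t) /\
       forall t, norm (minus (x' t) (x t)) <= rho * v t) ->
  forall x rho, 0 <= rho -> residual_bounded F x (fun t => rho * w t) ->
  exists z, is_solution F z /\
    forall t, norm (minus (z t) (x t)) <= rho / (1 - q) * v t.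
Proof.
  intros HF HK K0 Hq Hw Hv v0 step x rho Hrho Hx.
  assert (rq : forall n, 0 <= rho * q ^ n).
  { intros n. apply Rmult_le_pos; [exact Hrho | apply pow_le; lra]. }
  set (next := fun n y => epsilon (inhabits y) (fun y' =>
    residual_bounded F y' (fun t => rho * q ^ n * q * w t) /\
    forall t, norm (minus (y' t) (y t)) <= rho * q ^ n * v t)).
  set (xs := fix xs n := match n with O => x | S n => next n (xs n) end).
  assert (Hnext : forall n y, residual_bounded F y (fun t => rho * q ^ n * w t) ->
    residual_bounded F (next n y) (fun t => rho * q ^ n * q * w t) /\
    forall t, norm (minus (next n y t) (y t)) <= rho * q ^ n * v t).
  { intros n y Hy. unfold next. apply epsilon_spec. apply step; [apply rq | exact Hy]. }
  assert (Hres : forall n, residual_bounded F (xs n) (fun t => rho * q ^ n * w t)).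
  { induction n as [|n IH].
    - destruct Hx as (r & rc & Hx & Hr). exists r. split; [exact rc | split; [assumption|]].
      intros t. simpl. rewrite Rmult_1_r. apply Hr.
    - destruct (proj1 (Hnext n _ IH)) as (r & rc & Hy & Hr).
      exists r. split; [exact rc | split; [assumption|]].
      intros t. replace (rho * q ^ S n) with (rho * q ^ n * q) by (simpl; ring). apply Hr. }
  set (rho' := rho / (1 - q)).
  assert (Hrho' : rho = rho' * (1 - q)) by (unfold rho'; field; lra).
  assert (rho'0 : 0 <= rho') by (apply Rmult_le_pos; [lra | left; apply Rinv_0_lt_compat; lra]).
  assert (Hdist : forall n m t,
    norm (minus (xs (n + m)%nat t) (xs n t)) <= rho' * v t * (q ^ n - q ^ (n + m))).
  { intros n m t. induction m as [|m IH].
    - rewrite Nat.add_0_r minus_eq_zero norm_zero. right. ring.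
    - replace (n + S m)%nat with (S (n + m)) by lia.
      eapply Rle_trans; [apply (norm_minus_trans _ (xs (n + m)%nat t))|].
      eapply Rle_trans;
        [apply Rplus_le_compat; [apply (proj2 (Hnext _ _ (Hres (n + m)%nat)) t) | exact IH]|].
      right. rewrite Hrho'. simpl. ring. }
  assert (Hlim : forall t, exists l, forall n, norm (minus l (xs n t)) <= rho' * v t * q ^ n).
  { intros t. apply cauchy_limit; [|apply is_lim_seq_scaled_geom, Hq].
    intros n m. eapply Rle_trans; [apply Hdist|].
    apply Rmult_le_compat_l; [apply Rmult_le_pos; trivial|].
    pose proof (pow_le q (n + m) ltac:(lra)). lra. }
  set (z := fun t => epsilon (inhabits zero)
                       (fun l => forall n, norm (minus l (xs n t)) <= rho' * v t * q ^ n)).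
  assert (Hz : forall t n, norm (minus (z t) (xs n t)) <= rho' * v t * q ^ n).
  { intros t. exact (epsilon_spec _ _ (Hlim t)). }
  exists z. split.
  - apply (is_solution_of_approximations F K rho' q (fun t => (1 - q) * w t) v xs); trivial.
    + intros T. destruct (Hw T) as [B HB]. exists ((1 - q) * B). intros t Ht.
      apply Rmult_le_compat_l; [lra | apply HB, Ht].
    + intros n. destruct (Hres n) as (r & rc & Hy & Hr).
      exists r. split; [exact rc | split; [assumption|]]. intros t.
      eapply Rle_trans; [apply Hr|]. right. rewrite Hrho'. ring.
    + intros n t. eapply Rle_trans; [apply Hz|]. right. ring.
  - intros t. eapply Rle_trans; [apply (Hz t O)|]. right. simpl. ring.
Qed.

(** * The Cauchy problem *)

(** This is [|sinh (2 * K * tau)|]; it bounds the distance of the evolution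
    operator over a time [tau] from the identity. *)
Definition spread (K tau : R) : R :=
  Rabs (exp (2 * K * tau) - exp (- (2 * K * tau))) / 2.

Lemma spread_nonneg K tau : 0 <= spread K tau.
Proof.
  unfold spread. pose proof (Rabs_pos (exp (2 * K * tau) - exp (- (2 * K * tau)))). lra.
Qed.

Lemma spread_opp K tau : spread K (- tau) = spread K tau.
Proof.
  unfold spread. replace (2 * K * - tau) with (- (2 * K * tau)) by ring.
  rewrite Ropp_involutive Rabs_minus_sym. reflexivity.
Qed.

Lemma spread_0 K : spread K 0 = 0.
Proof.
  unfold spread. rewrite Rmult_0_r Ropp_0 Rminus_diag Rabs_R0. lra.
Qed.

Lemma exp_pair_ge_2 (a : R) : 2 <= exp a + exp (- a).
Proof.
  rewrite exp_Ropp. pose proof (exp_pos a) as He.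
  revert He. generalize (exp a) as e. intros e He.
  assert (0 <= (e - 1) * (e - 1) / e).
  { apply Rmult_le_pos; [apply (Rle_0_sqr (e - 1)) | left; apply Rinv_0_lt_compat, He]. }
  replace (e + / e) with (2 + (e - 1) * (e - 1) / e) by (field; lra). lra.
Qed.

Lemma exp_shifted_le (K s T t : R) :
  0 <= K -> Rabs t <= T -> exp (2 * K * (t - s)) + exp (- (2 * K * (t - s)))
    <= 2 * exp (2 * K * (T + Rabs s)).
Proof.
  intros HK Ht.
  assert (H : forall a, Rabs a <= T + Rabs s -> exp (2 * K * a) <= exp (2 * K * (T + Rabs s))).
  { intros a Ha. pose proof (Rle_abs a).
    destruct (Rle_lt_or_eq_dec (2 * K * a) (2 * K * (T + Rabs s))) as [Hlt | ->];
      [apply Rmult_le_compat_l; lra | left; apply exp_increasing, Hlt | lra]. }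
  assert (Hts : Rabs (t - s) <= T + Rabs s).
  { unfold Rminus. pose proof (Rabs_triang t (- s)). rewrite Rabs_Ropp in H0. lra. }
  pose proof (H (t - s) Hts) as H1.
  rewrite -Rabs_Ropp in Hts. pose proof (H (- (t - s)) Hts) as H2.
  replace (2 * K * - (t - s)) with (- (2 * K * (t - s))) in H2 by ring. lra.
Qed.

Lemma spread_small (K t eps : R) :
  0 < eps -> locally t (fun s => spread K (s - t) < eps).
Proof.
  intros He.
  assert (Hc : continuous (fun s => exp (2 * K * (s - t)) - exp (- (2 * K * (s - t)))) t).
  { apply: ex_derive_continuous. auto_derive. trivial. }
  pose proof (proj1 (continuous_norm_lt _ t) Hc (2 * eps) ltac:(lra)) as H.
  generalize H. apply filter_imp. intros s Hs.
  change (Rabs (exp (2 * K * (s - t)) - exp (- (2 * K * (s - t))) -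
                (exp (2 * K * (t - t)) - exp (- (2 * K * (t - t))))) < 2 * eps) in Hs.
  rewrite Rminus_diag Rmult_0_r Ropp_0 Rminus_diag Rminus_0_r in Hs.
  unfold spread. lra.
Qed.

(** Picard iteration with the two-sided exponential weight [w]. Its primitive [k]
    vanishes at [s] and satisfies [K * |k| <= w / 2], so correcting by the
    primitive of the residual from [s] halves the weighted residual and leaves
    the value at [s] fixed. *)
Lemma cauchy_problem_solvable (F : R -> X -> X) (K M s : R) (v : X) :
  preserves_continuity F -> lipschitz_field F K -> 0 < K ->
  (forall t, norm (F t v) <= M) ->
  exists x, is_solution F x /\
    forall t, norm (minus (x t) v) <= M / K * spread K (t - s).
Proof.
  intros HF HK K0 HM.
  set (w := fun t => exp (2 * K * (t - s)) + exp (- (2 * K * (t - s)))).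
  set (k := fun t => (exp (2 * K * (t - s)) - exp (- (2 * K * (t - s)))) / (2 * K)).
  assert (Hk : forall t, is_derive k t (w t)).
  { intros t. unfold k, w, Rminus. auto_derive; [trivial | field; lra]. }
  assert (Hks : k s = 0).
  { unfold k. rewrite Rminus_diag Rmult_0_r Ropp_0. field. lra. }
  assert (Hkv : forall t, Rabs (k t) = spread K (t - s) / K).
  { intros t. unfold k, spread. rewrite Rabs_div; [|lra].
    rewrite (Rabs_pos_eq (2 * K)); [field|]; lra. }
  assert (Hwb : locally_bounded w).
  { intros T. exists (2 * exp (2 * K * (T + Rabs s))). intros t Ht.
    apply exp_shifted_le; lra. }
  assert (Hsw : forall t, spread K (t - s) <= w t / 2).
  { intros t. unfold spread, w.
    pose proof (exp_pos (2 * K * (t - s))). pose proof (exp_pos (- (2 * K * (t - s)))).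
    apply Rmult_le_compat_r; [lra|]. apply Rabs_le. lra. }
  assert (HM0 : 0 <= M) by exact (Rle_trans _ _ _ (norm_ge_0 (F s v)) (HM s)).
  destruct (successive_corrections F K (1 / 2) w (fun t => Rabs (k t)) HF HK)
    with (x := fun _ : R => v) (rho := M / 2) as [x [Hx Hxv]]; try lra; trivial.
  - intros T. destruct (Hwb T) as [B HB]. exists (B / 2 / K). intros t Ht.
    rewrite Hkv. apply Rmult_le_compat_r; [left; apply Rinv_0_lt_compat, K0|].
    pose proof (Hsw t). pose proof (HB t Ht). lra.
  - intros t. apply Rabs_pos.
  - intros y rho Hrho (r & rc & Hy & Hr).
    destruct (primitive_exists r s rc) as [d [Hds Hd]].
    assert (Hdn : forall t, norm (d t) <= rho * Rabs (k t)).
    { intros t. rewrite -(Rabs_pos_eq rho Hrho) -Rabs_mult.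
      replace (rho * k t) with (rho * k t - rho * k s) by (rewrite Hks; ring).
      replace (d t) with (minus (d t) (d s)) by (rewrite Hds; abelian).
      apply (norm_increment_le_abs d r (fun t => rho * k t) (fun t => rho * w t)); trivial.
      intros u. apply: is_derive_scal. apply Hk. }
    exists (fun t => plus (y t) (d t)).
    assert (Hyd : forall t, minus (plus (y t) (d t)) (y t) = d t) by (intros; abelian).
    split; [|intros t; rewrite Hyd; apply Hdn].
    exists (fun t => minus (F t (plus (y t) (d t))) (F t (y t))).
    assert (yc : forall t, continuous y t) by (intros t; eapply is_derive_continuous, Hy).
    assert (dc : forall t, continuous d t) by (intros t; eapply is_derive_continuous, Hd).
    split; [|split].
    + intros t. apply: continuous_minus; [|apply HF, yc].
      apply (HF (fun t => plus (y t) (d t))). intros u.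
      apply: continuous_plus; [apply yc | apply dc].
    + intros t. eapply is_derive_eq; [apply: is_derive_plus; [apply Hy | apply Hd]|].
      abelian.
    + intros t. eapply Rle_trans; [apply HK|]. rewrite Hyd.
      pose proof (Rmult_le_compat_l K _ _ (Rlt_le _ _ K0) (Hdn t)) as H.
      rewrite Hkv in H.
      replace (K * (rho * (spread K (t - s) / K))) with (rho * spread K (t - s)) in H
        by (field; lra).
      pose proof (Rmult_le_compat_l rho _ _ Hrho (Hsw t)). lra.
  - exists (fun t => F t v). split; [|split].
    + intros t. apply (HF (fun _ => v)). intros. apply continuous_const.
    + intros t. rewrite minus_eq_zero. apply is_derive_const.
    + intros t. pose proof (exp_pair_ge_2 (2 * K * (t - s))). fold (w t) in H.
      pose proof (HM t). nra.
  - exists x. split; [exact Hx|]. intros t. eapply Rle_trans; [apply Hxv|].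
    right. rewrite Hkv. field. lra.
Qed.

(** * The evolution family *)

Section Evolution.

Context (A : R -> X -> X) (T : R -> R -> X -> X) (K : R).
Context (A_linear : forall t, is_linear (A t)).
Context (A_continuity : preserves_continuity A).
Context (A_bounded : forall t v, norm (A t v) <= K * norm v).
Context (K_pos : 0 < K).
Context (T_evolution : is_evolution_family A T).

Lemma linear_lipschitz : lipschitz_field A K.
Proof. intros t x y. rewrite -(linear_minus (A t)); [apply A_bounded | apply A_linear]. Qed.

Lemma evolution_linear t s : is_linear (T t s).
Proof. apply T_evolution. Qed.

(** [T] is only prescribed along solutions, but a solution passes through every
    [v] at time [s], and [T t s v] is its value at [t]. *)
Lemma evolution_orbit (s : R) (v : X) :
  T s s v = v /\ is_solution A (fun t => T t s v) /\
  forall t, norm (minus (T t s v) v) <= norm v * spread K (t - s).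
Proof.
  destruct (cauchy_problem_solvable A K (K * norm v) s v A_continuity linear_lipschitz K_pos)
    as [x [Hx Hxv]]; [intros t; apply A_bounded|].
  assert (Hxs : x s = v).
  { apply norm_minus_zero_eq. eapply Rle_trans; [apply Hxv|].
    rewrite Rminus_diag spread_0. right. ring. }
  assert (HT : forall t, x t = T t s v).
  { intros t. rewrite -Hxs. symmetry. apply T_evolution, Hx. }
  split; [|split].
  - rewrite -HT. exact Hxs.
  - intros t. apply (is_derive_ext x); [exact HT|]. rewrite -HT. apply Hx.
  - intros t. rewrite -HT. eapply Rle_trans; [apply Hxv|].
    right. field. lra.
Qed.

Lemma evolution_diag s v : T s s v = v.
Proof. apply evolution_orbit. Qed.

Lemma evolution_cocycle t s r v : T t s (T s r v) = T t r v.
Proof.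
  destruct T_evolution as [_ H]. apply (H (fun t => T t r v)). apply evolution_orbit.
Qed.

(** [T a s] depends on [s] through [T a t] composed with [T t s], which is close
    to the identity in norm for [s] near [t]. *)
Lemma evolution_curve_continuous (a : R) (g : R -> X) :
  (forall t, continuous g t) -> forall t, continuous (fun s => T a s (g s)) t.
Proof.
  intros Hg t.
  apply (continuous_ext (fun s => T a t (T t s (g s)))).
  { intros s. apply evolution_cocycle. }
  apply (continuous_comp (fun s => T t s (g s)) (T a t));
    [|apply linear_cont, evolution_linear].
  apply (proj2 (continuous_norm_lt (fun s => T t s (g s)) t)).
  intros eps He. rewrite evolution_diag.
  set (N := norm (g t) + 1).
  assert (HN : 0 < N) by (pose proof (norm_ge_0 (g t)); unfold N; lra).
  pose proof (proj1 (continuous_norm_lt g t) (Hg t)) as Hg'.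
  pose proof (filter_and _ _ (Hg' 1 Rlt_0_1) (Hg' (eps / 2) ltac:(lra))) as Hgt.
  assert (He' : 0 < eps / (2 * N)) by (apply Rdiv_lt_0_compat; lra).
  generalize (filter_and _ _ Hgt (spread_small K t _ He')).
  apply filter_imp. intros s [[H1 H2] H3].
  eapply Rle_lt_trans; [apply (norm_minus_trans _ (g s))|].
  destruct (evolution_orbit s (g s)) as (_ & _ & H4). specialize (H4 t).
  rewrite -(Ropp_minus_distr s t) spread_opp in H4.
  pose proof (norm_le_minus (g s) (g t)) as H5.
  assert (norm (g s) * spread K (s - t) <= N * (eps / (2 * N))).
  { apply Rmult_le_compat; [apply norm_ge_0 | apply spread_nonneg | unfold N |]; lra. }
  replace (N * (eps / (2 * N))) with (eps / 2) in H by (field; lra). lra.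
Qed.

(** The product rule. With [m s = T t a (w s)], the curve is
    [T s t (m t) + (T s t - Id) (m s - m t) + (m s - m t)]; the middle term [e] has
    derivative zero because both factors vanish at [t], the first one in norm. *)
Lemma evolution_curve_derive (a t : R) (w : R -> X) (l : X) :
  is_derive w t l ->
  is_derive (fun s => T s a (w s)) t (plus (A t (T t a (w t))) (T t a l)).
Proof.
  intros Hw.
  set (m := fun s => T t a (w s)).
  assert (Hm : is_derive m t (T t a l)).
  { exact (is_derive_linear (T t a) w t l (evolution_linear t a) Hw). }
  set (e := fun s => minus (T s t (minus (m s) (m t))) (minus (m s) (m t))).
  assert (Het : e t = zero).
  { unfold e. rewrite evolution_diag. apply minus_eq_zero. }
  assert (He : is_derive e t zero).
  { apply (proj2 (is_derive_domin e t zero)). intros eps Heps.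
    set (N := norm (T t a l) + 1).
    assert (HN : 0 < N) by (pose proof (norm_ge_0 (T t a l)); unfold N; lra).
    assert (He' : 0 < eps / N) by (apply Rdiv_lt_0_compat; lra).
    generalize (filter_and _ _ (is_derive_locally_lipschitz m t _ 1 Hm Rlt_0_1)
                  (spread_small K t _ He')).
    apply filter_imp. intros s [H1 H2].
    rewrite Het scal_zero_r.
    rewrite !minus_zero_r.
    eapply Rle_trans; [apply evolution_orbit|].
    eapply Rle_trans;
      [apply Rmult_le_compat;
         [apply norm_ge_0 | apply spread_nonneg | exact H1 | left; exact H2]|].
    fold N. right. field. lra. }
  apply (is_derive_ext (fun s => plus (T s t (m t)) (plus (e s) (minus (m s) (m t))))).
  { intros s. transitivity (T s t (m s)).
    - unfold e. rewrite (linear_minus (T s t)); [abelian | apply evolution_linear].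
    - apply evolution_cocycle. }
  eapply is_derive_eq.
  - apply: is_derive_plus; [apply evolution_orbit|].
    apply: is_derive_plus; [exact He|].
    apply: is_derive_minus; [exact Hm | apply is_derive_const].
  - rewrite evolution_diag. unfold m. abelian.
Qed.

(** * Bounded solutions of the inhomogeneous equation *)

Section Trichotomy.

Context (P : index3 -> R -> X -> X) (C lambda : R).
Context (C_pos : 0 < C).
Context (lambda_pos : 0 < lambda).
Context (P_trichotomy : is_trichotomy T P C lambda).

Lemma component_bound i t s c v :
  Rbar_le (op_norm (fun v => T t s (P i s v))) (Finite c) ->
  norm (T t s (P i s v)) <= c * norm v.
Proof.
  intros H. apply (op_norm_bound (fun v => T t s (P i s v)) c); [|exact H].
  intros k x. rewrite (linear_scal (P i s)); [|apply P_trichotomy].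
  apply (linear_scal (T t s)), evolution_linear.
Qed.

Section Forcing.

Context (g : R -> X) (gamma : R).
Context (g_continuous : forall t, continuous g t).
Context (g_bounded : forall t, norm (g t) <= gamma).

(** The [i]-th component of the Duhamel integral of [g], transported to time
    [0]. *)
Definition is_component (i : index3) (W : R -> X) : Prop :=
  W 0 = zero /\ forall s, is_derive W s (P i 0 (T 0 s (g s))).

Lemma component_exists i : exists W, is_component i W.
Proof.
  apply primitive_exists. intros t.
  apply (continuous_comp (fun s => T 0 s (g s)) (P i 0)).
  - apply evolution_curve_continuous, g_continuous.
  - apply linear_cont, P_trichotomy.
Qed.

Lemma component_derive i W t s :
  is_component i W -> is_derive (fun r => T t 0 (W r)) s (T t s (P i s (g s))).
Proof.
  intros [_ HW].
  replace (T t s (P i s (g s))) with (T t 0 (P i 0 (T 0 s (g s)))).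
  - apply (is_derive_linear (T t 0) W); [apply evolution_linear | apply HW].
  - rewrite -(trich_comm _ _ _ _ P_trichotomy). apply evolution_cocycle.
Qed.

Lemma gamma_nonneg : 0 <= gamma.
Proof. exact (Rle_trans _ _ _ (norm_ge_0 (g 0)) (g_bounded 0)). Qed.

Lemma decay_constant_nonneg : 0 <= C * gamma / lambda.
Proof.
  pose proof gamma_nonneg.
  apply Rmult_le_pos; [nra | left; apply Rinv_0_lt_compat, lambda_pos].
Qed.

(** The exponential bound on [T t s (P i s (g s))] is integrated by comparing with
    an explicit primitive [k] of it. *)
Lemma component_forward_decay i W t a b :
  is_component i W -> a <= b ->
  (forall s, a <= s <= b ->
     Rbar_le (op_norm (fun v => T t s (P i s v))) (C * exp (- lambda * (t - s)))) ->
  norm (minus (T t 0 (W b)) (T t 0 (W a)))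
    <= C * gamma / lambda * exp (- lambda * (t - b)).
Proof.
  intros HW Hab HT.
  set (k := fun s => C * gamma / lambda * exp (- lambda * (t - s))).
  apply Rle_trans with (k b - k a).
  - apply (norm_increment_le (fun s => T t 0 (W s)) (fun s => T t s (P i s (g s)))
             k (fun s => C * exp (- lambda * (t - s)) * gamma)); trivial.
    + intros s _. apply component_derive, HW.
    + intros s _. unfold k, Rminus. auto_derive; [trivial | field; lra].
    + intros s Hs. eapply Rle_trans; [apply component_bound, HT, Hs|].
      apply Rmult_le_compat_l; [|apply g_bounded].
      apply Rmult_le_pos; [lra | left; apply exp_pos].
  - assert (0 <= k a); [|unfold k in *; lra].
    apply Rmult_le_pos; [apply decay_constant_nonneg | left; apply exp_pos].
Qed.

Lemma component_backward_decay i W t a b :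
  is_component i W -> a <= b ->
  (forall s, a <= s <= b ->
     Rbar_le (op_norm (fun v => T t s (P i s v))) (C * exp (- lambda * (s - t)))) ->
  norm (minus (T t 0 (W b)) (T t 0 (W a)))
    <= C * gamma / lambda * exp (- lambda * (a - t)).
Proof.
  intros HW Hab HT.
  set (k := fun s => - (C * gamma / lambda * exp (- lambda * (s - t)))).
  apply Rle_trans with (k b - k a).
  - apply (norm_increment_le (fun s => T t 0 (W s)) (fun s => T t s (P i s (g s)))
             k (fun s => C * exp (- lambda * (s - t)) * gamma)); trivial.
    + intros s _. apply component_derive, HW.
    + intros s _. unfold k, Rminus. auto_derive; [trivial | field; lra].
    + intros s Hs. eapply Rle_trans; [apply component_bound, HT, Hs|].
      apply Rmult_le_compat_l; [|apply g_bounded].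
      apply Rmult_le_pos; [lra | left; apply exp_pos].
  - assert (0 <= - k b); [|unfold k in *; lra]. unfold k. rewrite Ropp_involutive.
    apply Rmult_le_pos; [apply decay_constant_nonneg | left; apply exp_pos].
Qed.

Lemma decay_le_1 a : 0 <= a -> exp (- lambda * a) <= 1.
Proof.
  intros Ha. rewrite -exp_0.
  destruct (Rle_lt_or_eq_dec (- lambda * a) 0) as [H | ->];
    [nra | left; apply exp_increasing, H | lra].
Qed.

Lemma decay_le_constant a : 0 <= a ->
  C * gamma / lambda * exp (- lambda * a) <= C * gamma / lambda.
Proof.
  intros Ha. rewrite -{2}(Rmult_1_r (C * gamma / lambda)).
  apply Rmult_le_compat_l; [apply decay_constant_nonneg | apply decay_le_1, Ha].
Qed.

Lemma decay_ratio : 0 <= exp (- lambda) < 1.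
Proof.
  split; [left; apply exp_pos|]. rewrite -exp_0. apply exp_increasing. lra.
Qed.

(** The improper integral of a component from one end of the line is the limit
    of [W] along times [tau n] that tend to that end. The bound at time [t] is
    uniform in [n], and the operator [T t 0], whose norm [M] is not controlled
    uniformly in [t], acts on a geometrically small error. *)
Lemma component_limit (W : R -> X) (tau : nat -> R) :
  (forall n m, norm (minus (T 0 0 (W (tau (n + m)%nat))) (T 0 0 (W (tau n))))
                 <= C * gamma / lambda * exp (- lambda * INR n)) ->
  (forall t, exists N, forall n, (N <= n)%nat ->
     norm (minus (T t 0 (W t)) (T t 0 (W (tau n)))) <= C * gamma / lambda) ->
  exists a, forall t, norm (T t 0 (minus (W t) a)) <= C * gamma / lambda.
Proof.
  intros Hcauchy Hbound.
  destruct (cauchy_limit (fun n => W (tau n))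
              (fun n => C * gamma / lambda * exp (- lambda) ^ n)) as [a Ha].
  { intros n m. rewrite -exp_INR_mult. rewrite -(evolution_diag 0 (W (tau (n + m)%nat))).
    rewrite -(evolution_diag 0 (W (tau n))). apply Hcauchy. }
  { apply is_lim_seq_scaled_geom, decay_ratio. }
  exists a. intros t.
  destruct (Hbound t) as [N HN].
  destruct (linear_norm _ (evolution_linear t 0)) as [M [M0 HM]].
  apply (le_of_geometric_error _ _ (M * (C * gamma / lambda)) (exp (- lambda)) N decay_ratio).
  intros n Hn.
  replace (T t 0 (minus (W t) a))
    with (minus (minus (T t 0 (W t)) (T t 0 (W (tau n)))) (T t 0 (minus a (W (tau n)))))
    by (rewrite !(linear_minus (T t 0)); [abelian | apply evolution_linear..]).
  eapply Rle_trans; [apply norm_minus_le|].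
  apply Rplus_le_compat; [apply HN, Hn|].
  eapply Rle_trans; [apply HM|]. rewrite Rmult_assoc.
  apply Rmult_le_compat_l; [lra | apply Ha].
Qed.

Lemma stable_component_limit W :
  is_component i1 W ->
  exists a, forall t, norm (T t 0 (minus (W t) a)) <= C * gamma / lambda.
Proof.
  intros HW. apply (component_limit W (fun n => - INR n)).
  - intros n m. rewrite norm_minus_sym.
    replace (- lambda * INR n) with (- lambda * (0 - - INR n)) by ring.
    apply (component_forward_decay i1); [exact HW| |].
    + rewrite plus_INR. pose proof (pos_INR m). lra.
    + intros s Hs. apply (trich_stable _ _ _ _ P_trichotomy).
      pose proof (pos_INR n). lra.
  - intros t. destruct (INR_unbounded (- t)) as [N HN]. exists N. intros n Hn.
    apply le_INR in Hn.
    eapply Rle_trans; [apply (component_forward_decay i1 W); [exact HW | lra |]|].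
    + intros s Hs. apply (trich_stable _ _ _ _ P_trichotomy). lra.
    + apply decay_le_constant. lra.
Qed.

Lemma unstable_component_limit W :
  is_component i2 W ->
  exists a, forall t, norm (T t 0 (minus (W t) a)) <= C * gamma / lambda.
Proof.
  intros HW. apply (component_limit W INR).
  - intros n m.
    replace (- lambda * INR n) with (- lambda * (INR n - 0)) by ring.
    apply (component_backward_decay i2); [exact HW| |].
    + rewrite plus_INR. pose proof (pos_INR m). lra.
    + intros s Hs. apply (trich_unstable _ _ _ _ P_trichotomy).
      pose proof (pos_INR n). lra.
  - intros t. destruct (INR_unbounded t) as [N HN]. exists N. intros n Hn.
    apply le_INR in Hn. rewrite norm_minus_sym.
    eapply Rle_trans; [apply (component_backward_decay i2 W); [exact HW | lra |]|].
    + intros s Hs. apply (trich_unstable _ _ _ _ P_trichotomy). lra.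
    + apply decay_le_constant. lra.
Qed.

Lemma neutral_component_bound W t :
  is_component i3 W -> norm (T t 0 (W t)) <= C * gamma / lambda.
Proof.
  intros HW.
  assert (E : T t 0 (W 0) = zero).
  { rewrite (proj1 HW). apply linear_zero, evolution_linear. }
  replace (T t 0 (W t)) with (minus (T t 0 (W t)) (T t 0 (W 0))) by (rewrite E; abelian).
  destruct (Rle_dec 0 t) as [Ht|Ht].
  - eapply Rle_trans; [apply (component_forward_decay i3 W); [exact HW | lra |]|].
    + intros s Hs. apply (trich_forward _ _ _ _ P_trichotomy). lra.
    + apply decay_le_constant. lra.
  - rewrite norm_minus_sym.
    eapply Rle_trans; [apply (component_backward_decay i3 W); [exact HW | lra |]|].
    + intros s Hs. apply (trich_backward _ _ _ _ P_trichotomy). lra.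
    + apply decay_le_constant. lra.
Qed.

(** Variation of constants, with the initial value [- a1 - a2] chosen so that the
    stable and unstable components are integrated from [-oo] and [+oo]. *)
Lemma bounded_solution_exists :
  exists u : R -> X,
    (forall t, is_derive u t (plus (A t (u t)) (g t))) /\
    forall t, norm (u t) <= 3 * C / lambda * gamma.
Proof.
  destruct (component_exists i1) as [W1 HW1].
  destruct (component_exists i2) as [W2 HW2].
  destruct (component_exists i3) as [W3 HW3].
  destruct (stable_component_limit W1 HW1) as [a1 Ha1].
  destruct (unstable_component_limit W2 HW2) as [a2 Ha2].
  exists (fun t => T t 0 (plus (plus (minus (W1 t) a1) (minus (W2 t) a2)) (W3 t))).
  split; intros t.
  - set (w := fun t => plus (plus (minus (W1 t) a1) (minus (W2 t) a2)) (W3 t)).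
    assert (Hw : is_derive w t (T 0 t (g t))).
    { eapply is_derive_eq.
      - apply: is_derive_plus; [apply: is_derive_plus|].
        + apply: is_derive_minus; [apply HW1 | apply is_derive_const].
        + apply: is_derive_minus; [apply HW2 | apply is_derive_const].
        + apply HW3.
      - transitivity (plus (plus (P i1 0 (T 0 t (g t))) (P i2 0 (T 0 t (g t))))
                           (P i3 0 (T 0 t (g t)))); [abelian|].
        apply P_trichotomy. }
    eapply is_derive_eq; [apply (evolution_curve_derive 0 t w _ Hw)|].
    rewrite evolution_cocycle evolution_diag. reflexivity.
  - rewrite 2!(linear_plus _ (evolution_linear t 0)).
    eapply Rle_trans; [apply norm_triangle|].
    eapply Rle_trans; [apply Rplus_le_compat_r, norm_triangle|].
    eapply Rle_trans;
      [apply Rplus_le_compat; [apply Rplus_le_compat|];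
         [apply Ha1 | apply Ha2 | apply neutral_component_bound, HW3]|].
    right. field. lra.
Qed.

End Forcing.
End Trichotomy.
End Evolution.

(** * Shadowing *)

(** With [G] a primitive of [F t (y t)] and [H = y - G], the smoothed curve is
    [G] plus the mean of [H] over [[t, t + 1]]. The remainder [H] is
    [delta]-Lipschitz even though [y] itself has no uniform modulus of
    continuity, so the unit window moves it by at most [delta], and the derivative
    of the mean, the increment of [H] over the window, is at most [delta] too. *)
Lemma pseudotrajectory_smoothing (F : R -> X -> X) (K delta : R) (y : R -> X) :
  preserves_continuity F -> lipschitz_field F K -> 0 <= K -> pseudotrajectory F delta y ->
  exists x, residual_bounded F x (fun _ => (K + 1) * delta) /\
    forall t, norm (minus (x t) (y t)) <= delta.
Proof.
  intros HF HK K0 (dy & Hy & Hsup).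
  assert (Hdy : forall t, norm (minus (dy t) (F t (y t))) <= delta).
  { intros t.
    exact (Rbar_le_trans (Finite _) _ (Finite _)
             (sup_ge (fun t => Finite (norm (minus (dy t) (F t (y t))))) t) Hsup). }
  assert (yc : forall t, continuous y t) by (intros t; eapply is_derive_continuous, Hy).
  assert (Fyc : forall t, continuous (fun s => F s (y s)) t) by (apply HF, yc).
  destruct (primitive_exists (fun s => F s (y s)) 0 Fyc) as [G [_ HG]].
  set (H := fun t => minus (y t) (G t)).
  assert (HH : forall t, is_derive H t (minus (dy t) (F t (y t)))).
  { intros t. apply: is_derive_minus; [apply Hy | apply HG]. }
  assert (Hc : forall t, continuous H t) by (intros t; eapply is_derive_continuous, HH).
  assert (Hlip : forall t s, t <= s <= t + 1 -> norm (minus (H s) (H t)) <= delta).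
  { intros t s Hs.
    assert (Hd0 : 0 <= delta) by exact (Rle_trans _ _ _ (norm_ge_0 _) (Hdy 0)).
    eapply Rle_trans;
      [apply (norm_increment_le_const H (fun u => minus (dy u) (F u (y u))) delta);
         intros u _; [apply HH | apply Hdy]|].
    rewrite Rabs_pos_eq; [nra | lra]. }
  destruct (primitive_exists H 0 Hc) as [I [_ HI]].
  assert (HI1 : forall t, is_derive (fun s => I (s + 1)) t (H (t + 1))).
  { intros t. eapply is_derive_eq.
    - apply (is_derive_comp I (fun s => s + 1) t (H (t + 1)) 1); [apply HI|].
      auto_derive; trivial.
    - apply: scal_one. }
  set (x := fun t => plus (G t) (minus (I (t + 1)) (I t))).
  assert (Hx : forall t, is_derive x t (plus (F t (y t)) (minus (H (t + 1)) (H t)))).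
  { intros t. apply: is_derive_plus; [apply HG|].
    apply: is_derive_minus; [apply HI1 | apply HI]. }
  assert (Hxy : forall t, norm (minus (x t) (y t)) <= delta).
  { intros t.
    replace (minus (x t) (y t))
      with (minus (minus (I (t + 1)) (scal (t + 1) (H t))) (minus (I t) (scal t (H t)))).
    2: { replace (scal (t + 1) (H t)) with (plus (scal t (H t)) (H t)).
         - unfold x. unfold H at 2. abelian.
         - rewrite -{2}(scal_one (H t)). symmetry. apply: scal_distr_r. }
    replace delta with (delta * Rabs (t + 1 - t)).
    2: { replace (t + 1 - t) with 1 by ring. rewrite Rabs_R1. ring. }
    apply (norm_increment_le_const (fun s => minus (I s) (scal s (H t)))
             (fun s => minus (H s) (H t))).
    - intros s _. apply: is_derive_minus; [apply HI|].
      eapply is_derive_eq; [apply: is_derive_scal_l; apply is_derive_id | apply: scal_one].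
    - intros s. rewrite Rmin_left ?Rmax_right; [|lra..]. apply Hlip. }
  assert (xc : forall t, continuous x t) by (intros t; eapply is_derive_continuous, Hx).
  exists x. split; [|exact Hxy].
  exists (fun t => minus (minus (F t (x t)) (F t (y t))) (minus (H (t + 1)) (H t))).
  split; [|split].
  - intros t. apply: continuous_minus; apply: continuous_minus.
    + apply HF, xc.
    + apply Fyc.
    + apply (continuous_comp (fun s => s + 1) H); [|apply Hc].
      apply: continuous_plus; [apply continuous_id | apply continuous_const].
    + apply Hc.
  - intros t. eapply is_derive_eq; [apply Hx | abelian].
  - intros t. eapply Rle_trans; [apply norm_minus_le|].
    rewrite Rmult_plus_distr_r Rmult_1_l. apply Rplus_le_compat; [|apply Hlip; lra].
    eapply Rle_trans; [apply HK|]. apply Rmult_le_compat_l; [exact K0 | apply Hxy].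
Qed.

(** Adding to a curve the bounded solution [u] of the linear equation driven by
    its residual leaves only the increment of [f] along [u] as new residual, of
    relative size [c * kappa < 1]. *)
Lemma perturbed_field_lipschitz_shadowing
    (A f : R -> X -> X) (K c kappa : R) :
  preserves_continuity A -> (forall t, is_linear (A t)) -> lipschitz_field A K -> 0 <= K ->
  preserves_continuity f -> lipschitz_field f c -> 0 <= c ->
  0 < kappa -> c * kappa < 1 ->
  (forall (g : R -> X) gamma, (forall t, continuous g t) -> (forall t, norm (g t) <= gamma) ->
     exists u : R -> X, (forall t, is_derive u t (plus (A t (u t)) (g t))) /\
       forall t, norm (u t) <= kappa * gamma) ->
  exists L, 0 < L /\ forall eps, 0 < eps ->
    shadowable (fun t x => plus (A t x) (f t x)) eps (L * eps).
Proof.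
  intros HA Alin HAK K0 Hf Hfc c0 Hkap Hq Hsolve.
  set (F := fun t x => plus (A t x) (f t x)).
  assert (HF : preserves_continuity F).
  { intros x Hx t. apply: continuous_plus; [apply HA, Hx | apply Hf, Hx]. }
  assert (HFK : lipschitz_field F (K + c)).
  { intros t x y. unfold F.
    replace (minus (plus (A t x) (f t x)) (plus (A t y) (f t y)))
      with (plus (minus (A t x) (A t y)) (minus (f t x) (f t y))) by abelian.
    eapply Rle_trans; [apply norm_triangle|].
    rewrite Rmult_plus_distr_r. apply Rplus_le_compat; [apply HAK | apply Hfc]. }
  (* One [delta] for the smoothing, the rest for the sum of the corrections of
     the smoothed curve, whose residual is at most [(K + c + 1) * delta]. *)
  set (D := 1 + (K + c + 1) / (1 - c * kappa) * kappa).
  assert (HD : 1 <= D).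
  { assert (0 <= (K + c + 1) / (1 - c * kappa) * kappa); [|unfold D; lra].
    apply Rmult_le_pos; [|lra].
    apply Rmult_le_pos; [lra | left; apply Rinv_0_lt_compat; lra]. }
  exists (/ D). split; [apply Rinv_0_lt_compat; lra|].
  intros eps He y Hy.
  assert (Hde : 0 < / D * eps) by (apply Rmult_lt_0_compat; [apply Rinv_0_lt_compat|]; lra).
  set (delta := / D * eps) in *.
  destruct (pseudotrajectory_smoothing F (K + c) delta y HF HFK ltac:(lra) Hy)
    as (x & Hx & Hxy).
  destruct (successive_corrections F (K + c) (c * kappa) (fun _ => 1) (fun _ => kappa)
              HF HFK) with (x := x) (rho := (K + c + 1) * delta) as (z & Hz & Hzx).
  - lra.
  - split; [apply Rmult_le_pos|]; lra.
  - intros T. exists 1. intros; lra.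
  - intros T. exists kappa. intros; lra.
  - intros; lra.
  - intros p rho Hrho (r & rc & Hp & Hr).
    destruct (Hsolve r rho rc) as (u & Hu & Hub).
    { intros t. pose proof (Hr t). lra. }
    assert (pc : forall t, continuous p t) by (intros t; eapply is_derive_continuous, Hp).
    assert (uc : forall t, continuous u t) by (intros t; eapply is_derive_continuous, Hu).
    assert (Hpu : forall t, minus (plus (p t) (u t)) (p t) = u t) by (intros; abelian).
    exists (fun t => plus (p t) (u t)). split.
    + exists (fun t => minus (f t (plus (p t) (u t))) (f t (p t))). split; [|split].
      * intros t. apply: continuous_minus; [|apply Hf, pc].
        apply (Hf (fun t => plus (p t) (u t))). intros s.
        apply: continuous_plus; [apply pc | apply uc].
      * intros t. eapply is_derive_eq; [apply: is_derive_plus; [apply Hp | apply Hu]|].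
        unfold F. rewrite (linear_plus _ (Alin t)). abelian.
      * intros t. eapply Rle_trans; [apply Hfc|]. rewrite Hpu.
        eapply Rle_trans; [apply (Rmult_le_compat_l _ _ _ c0 (Hub t))|]. right. ring.
    + intros t. rewrite Hpu. rewrite Rmult_comm. apply Hub.
  - apply Rmult_le_pos; lra.
  - destruct Hx as (r & rc & Hx & Hr). exists r. split; [exact rc | split; [exact Hx|]].
    intros t. rewrite Rmult_1_r. apply Hr.
  - exists z. split; [exact Hz|]. apply sup_le. intros t. simpl.
    eapply Rle_trans; [apply (norm_minus_trans _ (x t))|].
    eapply Rle_trans; [apply Rplus_le_compat; [apply Hzx | apply Hxy]|].
    right. replace eps with (D * delta) by (unfold delta; field; lra).
    unfold D. field. lra.
Qed.

Lemma lipschitz_shadowing_of_modulus (F : R -> X -> X) :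
  (exists L, 0 < L /\ forall eps, 0 < eps -> shadowable F eps (L * eps)) ->
  lipschitz_shadowing F.
Proof.
  intros [L [HL H]]. split; [|exists L; auto].
  intros eps He. exists (L * eps). split; [apply Rmult_lt_0_compat | apply H]; trivial.
Qed.

Lemma operator_family_bounded (A : R -> X -> X) :
  (forall t, is_linear (A t)) -> Rbar_lt (sup (fun t => op_norm (A t))) p_infty ->
  exists K, 0 < K /\ forall t v, norm (A t v) <= K * norm v.
Proof.
  intros HA Hsup.
  assert (HK : exists K, Rbar_le (sup (fun t => op_norm (A t))) (Finite K)).
  { destruct (sup (fun t => op_norm (A t))) as [K| |]; [|destruct Hsup|].
    - exists K. apply Rle_refl.
    - exists 0. exact I. }
  destruct HK as [K HK]. exists (Rabs K + 1). split; [pose proof (Rabs_pos K); lra|].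
  intros t v. eapply Rle_trans.
  - apply (op_norm_bound (A t) K); [apply (linear_scal (A t)), HA|].
    eapply Rbar_le_trans; [apply (sup_ge (fun t => op_norm (A t)) t) | exact HK].
  - apply Rmult_le_compat_r; [apply norm_ge_0|]. pose proof (Rle_abs K). lra.
Qed.

Lemma op_continuous_preserves_continuity (A : R -> X -> X) (K : R) :
  (forall t, is_linear (A t)) -> 0 < K -> (forall t v, norm (A t v) <= K * norm v) ->
  op_continuous A -> preserves_continuity A.
Proof.
  intros HA K0 HK Hop x Hx t.
  apply (proj2 (continuous_norm_lt (fun s => A s (x s)) t)). intros eps He.
  set (N := norm (x t) + 1).
  assert (HN : 0 < N) by (pose proof (norm_ge_0 (x t)); unfold N; lra).
  assert (HeN : 0 < eps / (2 * N)) by (apply Rdiv_lt_0_compat; lra).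
  assert (HeK : 0 < eps / (2 * K)) by (apply Rdiv_lt_0_compat; lra).
  pose proof (proj1 (continuous_norm_lt x t) (Hx t) _ HeK) as Hx'.
  generalize (filter_and _ _ Hx' (Hop t (mkposreal _ HeN))).
  apply filter_imp. intros s [H1 H2]. simpl in H2.
  apply Rbar_lt_le in H2.
  assert (H3 : norm (minus (A s (x t)) (A t (x t))) <= eps / (2 * N) * norm (x t)).
  { apply (op_norm_bound (fun v => minus (A s v) (A t v))); [|exact H2].
    intros k v. rewrite !(linear_scal _ (HA _)). symmetry. apply: scal_minus_distr_l. }
  eapply Rle_lt_trans; [apply (norm_minus_trans _ (A s (x t)))|].
  rewrite -(linear_minus (A s)); [|apply HA].
  pose proof (HK s (minus (x s) (x t))).
  assert (K * norm (minus (x s) (x t)) < eps / 2).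
  { replace (eps / 2) with (K * (eps / (2 * K))) by (field; lra).
    apply Rmult_lt_compat_l; assumption. }
  assert (eps / (2 * N) * norm (x t) <= eps / 2).
  { replace (eps / 2) with (eps / (2 * N) * N) by (field; lra).
    apply Rmult_le_compat_l; [lra | unfold N; lra]. }
  lra.
Qed.

Lemma jointly_continuous_preserves_continuity (f : R -> X -> X) :
  (forall p : R * X, continuous (fun q : R * X => f (fst q) (snd q)) p) ->
  preserves_continuity f.
Proof.
  intros Hf x Hx t. apply: (continuous_comp_2 (fun s => s) x f);
    [apply continuous_id | apply Hx | apply Hf].
Qed.

End Complete.

Theorem theorem6 :
  forall (X : CompleteNormedModule R_AbsRing) (A : R -> X -> X)
    (T : R -> R -> X -> X),
    (forall t, is_linear (A t)) ->
    op_continuous A ->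
    Rbar_lt (sup (fun t => op_norm (A t))) p_infty ->
    is_evolution_family A T ->
    exponential_trichotomy T ->
    exists c0 : R, 0 < c0 /\
      forall c : R, 0 < c < c0 ->
      forall f : R -> X -> X,
        (forall p : R * X, continuous (fun q : R * X => f (fst q) (snd q)) p) ->
        (forall t, f t zero = zero) ->
        (forall t x y, norm (minus (f t x) (f t y)) <= c * norm (minus x y)) ->
        lipschitz_shadowing (fun t x => plus (A t x) (f t x)).
Proof.
  intros X A T Alin Aop Asup HT (P & C & lambda & HC & Hlam & Htri).
  destruct (operator_family_bounded A Alin Asup) as (K & K0 & HK).
  pose proof (op_continuous_preserves_continuity A K Alin K0 HK Aop) as Acont.
  assert (Hkappa : 0 < 3 * C / lambda) by (apply Rdiv_lt_0_compat; lra).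
  exists (/ (3 * C / lambda)). split; [apply Rinv_0_lt_compat, Hkappa|].
  intros c Hc f Hf _ Hfc.
  apply lipschitz_shadowing_of_modulus.
  apply (perturbed_field_lipschitz_shadowing A f K c (3 * C / lambda)); trivial.
  - exact (linear_lipschitz A K Alin HK).
  - lra.
  - apply jointly_continuous_preserves_continuity, Hf.
  - lra.
  - replace 1 with (/ (3 * C / lambda) * (3 * C / lambda)) by (field; lra).
    apply Rmult_lt_compat_r; lra.
  - intros g gamma Hg Hgb.
    exact (bounded_solution_exists A T K Alin Acont HK K0 HT P C lambda HC Hlam Htri
             g gamma Hg Hgb).
Qed.
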